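(* (Undirected case.) Let $G$ be a connected weighted simple graph on $n$ vertices. Then the generating function $f_G$ for spanning trees in $G$ can be computed by a subtraction-free arithmetic circuit of size $O(n^3)$. (Directed case.) Let $G$ be a weighted simple directed graph on $n$ vertices with a given vertex $r$ such that there is a directed path from every vertex to $r$. Then the generating function $\varphi_G$ for directed spanning trees in $G$ rooted at $r$ can be computed by a subtraction-free arithmetic circuit of size $O(n^3)$. The implied constants are absolute.
   Context: Subtraction-free circuits: an arithmetic circuit is a directed acyclic network whose gates each perform one binary arithmetic operation; its inputs are the variables and arbitrary positive integer scalars, and it outputs a rational function in the variables. It is subtraction-free if every gate is an addition, a multiplication or a division (no subtraction gates, no negative scalars). The size of a circuit is its number of gates. Graphs: a simple graph has no loops and no multiple edges. A simple directed graph has no loops and no two edges with the same source and the same target (opposite edges $a\to b$ and $b\to a$ are allowed). ''Weighted'' means that a formal variable $x_e$ is attached to each edge $e$ (distinct variables for distinct edges). Undirected generating function: $f_G=\sum_T x^T$, the sum over all spanning trees $T$ of $G$, where $x^T$ is the product of $x_e$ over the edges $e$ of $T$. Directed generating function: a directed spanning tree rooted at $r$ is a subgraph $T$ of $G$ containing all vertices which is a spanning tree (ignoring orientations) with all edges oriented towards $r$; equivalently, for every vertex $v$ there is a unique path in $T$ from $v$ to $r$. Then $\varphi_G=\sum_T x^T$, the sum over all directed spanning trees $T$ of $G$ rooted at $r$, with $x^T$ the product of $x_e$ over the edges $e$ of $T$. *)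

(* Defs.v *)
From HB Require Import structures.
From mathcomp Require Import all_boot all_order all_algebra.
From mathcomp Require Import mpoly.

Set Implicit Arguments.
Unset Strict Implicit.
Unset Printing Implicit Defensive.

Import GRing.Theory.
Local Open Scope ring_scope.

(** * Arithmetic circuits *)

Inductive arith_op := Add | Sub | Mul | Div.

(* What may be plugged into a gate: a variable, a positive integer scalar, or
   the output of the i-th gate (counting from 0). *)
Inductive source (X : Type) : Type :=
  | Var of X
  | Scalar (k : nat) of (0 < k)%N
  | Wire of nat.

Record gate (X : Type) := Gate {
  gate_op : arith_op;
  gate_left : source X;
  gate_right : source X
}.

(* The acyclic network is given by a topological ordering of its gates.
   Acyclicity is enforced by the evaluation below: a gate that refers to itself
   or to a later gate has no value.  Fan-out is unrestricted. *)
Record circuit (X : Type) := Circuit {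
  gates : seq (gate X);
  output : source X
}.

Definition circuit_size (X : Type) (c : circuit X) : nat := size (gates c).

Definition subtraction_free (X : Type) (c : circuit X) : bool :=
  all (fun g => if gate_op g is Sub then false else true) (gates c).

Section Evaluation.

Variables (X : Type) (F : fieldType) (rho : X -> F).

Definition source_val (vals : seq F) (s : source X) : option F :=
  match s with
  | Var x => Some (rho x)
  | Scalar k _ => Some k%:R
  | Wire i => onth vals i
  end.

(* Division by zero is undefined, rather than 0 as in [_ / 0]. *)
Definition op_val (o : arith_op) (a b : F) : option F :=
  match o with
  | Add => Some (a + b)
  | Sub => Some (a - b)
  | Mul => Some (a * b)
  | Div => if b == 0 then None else Some (a / b)
  end.

Definition gate_val (vals : seq F) (g : gate X) : option F :=
  match source_val vals (gate_left g), source_val vals (gate_right g) with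
  | Some a, Some b => op_val (gate_op g) a b
  | _, _ => None
  end.

(* [vals] lists the values of the gates that precede [gs]. *)
Fixpoint gates_val (vals : seq F) (gs : seq (gate X)) : option (seq F) :=
  if gs is g :: gs' then
    if gate_val vals g is Some a then gates_val (rcons vals a) gs' else None
  else Some vals.

Definition circuit_val (c : circuit X) : option F :=
  if gates_val [::] (gates c) is Some vals then source_val vals (output c)
  else None.

End Evaluation.

(* For a finite set E of variables, the variable x_e is ['X_(enum_rank e)];
   rational functions are the fractions of [{mpoly rat[#|E|]}]. *)
Definition computes (E : finType) (c : circuit E) (f : {mpoly rat[#|E|]}) : Prop :=
  circuit_val (fun e : E => tofrac ('X_(enum_rank e) : {mpoly rat[#|E|]})) c
  = Some (tofrac f).

Definition generating_function (E : finType) (P : pred {set E}) :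
    {mpoly rat[#|E|]} :=
  \sum_(T : {set E} | P T) \prod_(e in T) 'X_(enum_rank e).

(** * Trees *)

Section Trees.

Variable V : finType.

Definition connected_graph (t : rel V) : bool :=
  (0 < #|V|)%N && [forall x, forall y, connect t x y].

(* The vertices of a cycle are distinct, so its length is at most #|V|. *)
Definition acyclic_graph (t : rel V) : bool :=
  [forall k : 'I_(#|V|).+1, forall c : k.-tuple V,
     (2 < k)%N ==> ~~ ucycleb t c].

(* For a symmetric irreflexive relation t, seen as a simple graph on V. *)
Definition tree (t : rel V) : bool := connected_graph t && acyclic_graph t.

End Trees.

(** * Undirected graphs: a symmetric irreflexive relation on V *)

Section Undirected.

Variables (V : finType) (G : rel V).

Definition edge_set : {set {set V}} :=
  [set [set x; y] | x in V, y in V & G x y].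

Definition edge : finType := {e : {set V} | e \in edge_set}.

Definition adjacent (T : {set edge}) : rel V :=
  fun x y => [exists e in T, val e == [set x; y]].

Definition spanning_tree (T : {set edge}) : bool := tree (adjacent T).

Definition spanning_tree_gf : {mpoly rat[#|edge|]} :=
  generating_function spanning_tree.

End Undirected.

(** * Directed graphs: an irreflexive relation on V *)

Section Directed.

Variables (V : finType) (G : rel V).

Definition directed_edge : finType := {a : V * V | G a.1 a.2}.

Definition source_of (a : directed_edge) : V := (val a).1.
Definition target_of (a : directed_edge) : V := (val a).2.

(* Adjacency in T when orientations are ignored. *)
Definition adjacent_unoriented (T : {set directed_edge}) : rel V :=
  fun x y => [exists a in T, (val a == (x, y)) || (val a == (y, x))].

(* Two opposite arcs become parallel edges, hence a cycle, once orientations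
   are ignored; [adjacent_unoriented] does not see this. *)
Definition no_opposite_arcs (T : {set directed_edge}) : bool :=
  [forall a in T, forall b in T, val a != (target_of b, source_of b)].

(* In a tree, removing an arc a leaves two components; a points towards r when
   its target is in the component of r. *)
Definition oriented_towards (r : V) (T : {set directed_edge}) : bool :=
  [forall a in T, connect (adjacent_unoriented (T :\ a)) (target_of a) r].

Definition directed_spanning_tree (r : V) (T : {set directed_edge}) : bool :=
  [&& no_opposite_arcs T, tree (adjacent_unoriented T) & oriented_towards r T].

Definition directed_spanning_tree_gf (r : V) : {mpoly rat[#|directed_edge|]} :=
  generating_function (directed_spanning_tree r).

End Directed.

(* Main.v *)
(** A spanning tree directed towards r is the same as a parent function
    p : V -> V with p r = r all of whose orbits end in r.  Expanding the reduced
    Laplacian determinant row by row gives one term per parent function, the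
    determinant of an "identity minus p" matrix, which is 1 when p is rooted and
    0 otherwise.  Gaussian elimination of the vertex v multiplies the
    determinant by the outflow D of v and replaces the weights by
      w'(x,y) = w(x,y) + w(x,v) w(v,y) / D,
    in which no subtraction occurs because the Laplacian of the new weights is
    exactly the Schur complement.  Each elimination costs O(n^2) gates.  An
    undirected graph is handled as the directed graph with both orientations of
    each edge carrying the same variable. *)

Require Import Defs.
From mathcomp Require Import all_boot all_order all_fingroup all_algebra.
From mathcomp Require Import mpoly.

Set Implicit Arguments.
Unset Strict Implicit.
Unset Printing Implicit Defensive.

(** * Elimination of a vertex from the Laplacian *)

Section Laplacian.

Import GRing.Theory.
Local Open Scope ring_scope.

Lemma det_col_single (R : comNzRingType) (n : nat) (A : 'M[R]_n) (i : 'I_n) :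
  (forall j, j != i -> A j i = 0) ->
  \det A = A i i * \det (row' i (col' i A)).
Proof.
move=> A0; rewrite (expand_det_col A i) (bigD1 i) //= big1 => [|j /A0->].
  by rewrite addr0 /cofactor addnn -signr_odd odd_double expr0 mul1r.
by rewrite mul0r.
Qed.

(** All the row operations together are left multiplication by [E], which differs from the identity
    only in column [i]. Since [c i = 0], row [i] of [E] is a unit vector and the complementary minor
    is the identity, so [\det E = 1]. *)
Lemma det_add_row_multiples (R : comNzRingType) (n : nat) (A : 'M[R]_n)
    (i : 'I_n) (c : 'I_n -> R) :
  c i = 0 -> \det (\matrix_(j, k) (A j k + c j * A i k)) = \det A.
Proof.
move=> ci; pose E : 'M_n := \matrix_(j, k) ((j == k)%:R + (k == i)%:R * c j).
have -> : \matrix_(j, k) (A j k + c j * A i k) = E *m A.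
  apply/matrixP=> j k; rewrite !mxE; under eq_bigr do rewrite mxE mulrDl.
  rewrite big_split /= (bigD1 j) //= eqxx mul1r big1 ?addr0; last first.
    by move=> l; rewrite eq_sym => /negPf->; rewrite mul0r.
  rewrite (bigD1 i) //= eqxx mul1r big1 ?addr0 // => l /negPf->.
  by rewrite !mul0r.
rewrite det_mulmx -(det_tr E) (det_col_single (A := E^T) (i := i)) => [|j ji].
  rewrite !mxE eqxx ci mulr0 addr0 mul1r.
  have -> : row' i (col' i E^T) = 1%:M.
    apply/matrixP=> j k; rewrite !mxE (negPf (_ : lift i j != i)) ?mul0r ?addr0.
      by rewrite (inj_eq lift_inj) eq_sym.
    by rewrite eq_sym neq_lift.
  by rewrite det1 mul1r.
by rewrite !mxE eq_sym (negPf ji) mul0r addr0.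
Qed.

Variables (K : fieldType) (V : finType).
Implicit Types (w : V -> V -> K) (S : {set V}) (v : V).

Definition outflow w v : K := \sum_(z | z != v) w v z.

(** The case [x = y] creates self-loops, which cancel in the Laplacian. *)
Definition eliminate v w x y : K :=
  if y == v then 0 else w x y + w x v / outflow w v * w v y.

(* The self-loop terms [w x x] cancel on the diagonal. *)
Definition laplacian_entry S w x y : K :=
  if x \in S then (x == y)%:R * (\sum_z w x z) - w x y else (x == y)%:R.

(** Rows outside [S] are unit rows, so the determinant is the principal minor on [S], while the
    matrix size stays fixed as [S] shrinks. *)
Definition laplacian S w : 'M[K]_#|V| :=
  \matrix_(i, j) laplacian_entry S w (enum_val i) (enum_val j).

Lemma sum_outflow w v : \sum_z w v z = w v v + outflow w v.
Proof. by rewrite (bigD1 v). Qed.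

(** The weight [w x v] is shared out among the targets of [v] in proportions [w v z / outflow w v],
    which add up to 1. *)
Lemma row_sum_eliminate w v x : outflow w v != 0 ->
  \sum_z eliminate v w x z = \sum_z w x z.
Proof.
move=> D0; rewrite (bigD1 v) //= {1}/eliminate eqxx add0r.
under eq_bigr => z zv do rewrite /eliminate (negPf zv).
by rewrite big_split /= -mulr_sumr -/(outflow w v) divfK // addrC [RHS](bigD1 v).
Qed.

(** The pivot at [v] is the outflow. Adding multiples of row [v] clears the rest of column [v] and
    turns the other rows into those of the smaller Laplacian; expanding both determinants along
    column [v] leaves the same minor. *)
Lemma det_laplacian_eliminate S w v :
  v \in S -> outflow w v != 0 ->
  \det (laplacian S w) =
  outflow w v * \det (laplacian (S :\ v) (eliminate v w)).
Proof.
move=> vS D0; pose i := enum_rank v.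
pose c x := if x \in S :\ v then w x v / outflow w v else 0.
have iE : enum_val i = v by rewrite enum_rankK.
have vE j : (enum_val j == v) = (j == i).
  by rewrite -iE (inj_eq enum_val_inj).
rewrite -(det_add_row_multiples (laplacian S w) (i := i)
           (c := fun j => c (enum_val j))); last first.
  by rewrite /c iE setD11.
set A := \matrix_(j, k) _.
have AE j k : A j k =
    if j == i then laplacian_entry S w v (enum_val k)
    else laplacian (S :\ v) (eliminate v w) j k.
  rewrite !mxE iE /c in_setD1 -vE /laplacian_entry !in_setD1 vS.
  set x := enum_val j; set y := enum_val k.
  case: (eqVneq x v) => [->|xv] /=; first by rewrite vS mul0r addr0.
  case: (boolP (x \in S)) => xS; last by rewrite mul0r addr0.
  rewrite row_sum_eliminate // /eliminate (eq_sym v).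
  case: (eqVneq y v) => [->|yv]; last by rewrite mul0r sub0r mulrN opprD addrA.
  rewrite (negPf xv) mul0r mul1r sum_outflow (addrC (w v v)) addrK divfK //.
  by rewrite sub0r addNr subr0.
have AS : row' i (col' i A) =
    row' i (col' i (laplacian (S :\ v) (eliminate v w))).
  apply/matrixP=> j k; rewrite [LHS]mxE [LHS]mxE AE !mxE.
  by rewrite (negPf (_ : lift i j != i)) // eq_sym neq_lift.
rewrite !(det_col_single (i := i)) => [|j ji|j ji].
- rewrite AS AE eqxx [X in _ = _ * (X * _)]mxE iE /laplacian_entry vS.
  by rewrite !in_setD1 eqxx mul1r mul1r sum_outflow (addrC (w v v)) addrK.
- rewrite mxE iE /laplacian_entry vE (negPf ji) /eliminate eqxx.
  by case: ifP; rewrite ?mul0r ?subr0.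
- rewrite AE (negPf ji) mxE iE /laplacian_entry vE (negPf ji) /eliminate eqxx.
  by case: ifP; rewrite ?mul0r ?subr0.
Qed.

Lemma det_laplacian_set0 w : \det (laplacian set0 w) = 1.
Proof.
suff -> : laplacian set0 w = 1%:M by rewrite det1.
apply/matrixP=> i j; rewrite !mxE /laplacian_entry inE.
by rewrite (inj_eq enum_val_inj).
Qed.

End Laplacian.

(** * Values available in a partially built circuit *)

Section Availability.

Import GRing.Theory.
Local Open Scope ring_scope.

Variables (X : Type) (F : fieldType) (rho : X -> F).
Implicit Types (vals : seq F) (gs : seq (gate X)) (a b : F) (k : nat).

(** [k] is only an upper bound, so steps that need no gate can be charged as well. The output
    [Wire X 0] is a placeholder: [subtraction_free] inspects the gates alone. *)
Definition runs k vals vals' :=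
  exists gs, [/\ subtraction_free (Circuit gs (Wire X 0)), (size gs <= k)%N
               & gates_val rho vals gs = Some vals'].

Definition available vals a :=
  exists s : source X, source_val rho vals s = Some a.

Lemma gates_val_cat vals gs1 gs2 :
  gates_val rho vals (gs1 ++ gs2) =
  obind (gates_val rho ^~ gs2) (gates_val rho vals gs1).
Proof. by elim: gs1 vals => //= g gs1 IH vals; case: gate_val. Qed.

Lemma runs_prefix k vals vals' : runs k vals vals' -> prefix vals vals'.
Proof.
case=> gs [_ _]; elim: gs vals {k} => [|g gs IH] vals /=.
  by case=> ->; apply: prefix_refl.
case: gate_val => // a /IH; apply: prefix_trans.
by rewrite -cats1 prefix_prefix.
Qed.

Lemma runs0 vals : runs 0 vals vals.
Proof. by exists [::]. Qed.

Lemma runs_trans k1 k2 vals1 vals2 vals3 :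
  runs k1 vals1 vals2 -> runs k2 vals2 vals3 -> runs (k1 + k2) vals1 vals3.
Proof.
case=> gs1 [f1 s1 e1] [gs2 [f2 s2 e2]]; exists (gs1 ++ gs2); split.
- by rewrite /subtraction_free /= all_cat; apply/andP.
- by rewrite size_cat leq_add.
- by rewrite gates_val_cat e1.
Qed.

Lemma runs_weaken k1 k2 vals vals' :
  (k1 <= k2)%N -> runs k1 vals vals' -> runs k2 vals vals'.
Proof. by move=> le12 [gs [f s e]]; exists gs; split=> //; apply: leq_trans le12. Qed.

Lemma available_prefix vals vals' a :
  prefix vals vals' -> available vals a -> available vals' a.
Proof.
case/prefixP=> l -> [[x|n n0|i] /= e]; [by exists (Var x)|by exists (Scalar _ n0)|].
exists (Wire X i) => /=; rewrite onth_cat ifT //.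
by rewrite ltnNge; apply/negP => /onth_default; rewrite e.
Qed.

Lemma available_gate (o : arith_op) vals a b c :
  o <> Defs.Sub -> op_val o a b = Some c -> available vals a -> available vals b ->
  exists2 vals', runs 1 vals vals' & available vals' c.
Proof.
move=> oS oE [s1 e1] [s2 e2]; exists (rcons vals c).
  exists [:: Gate o s1 s2]; split=> //; first by case: o oS {oE}.
  by rewrite /= /gate_val /= e1 e2 oE.
by exists (Wire X (size vals)); rewrite /= -cats1 onth_cat ltnn subnn.
Qed.

(* [pos] stands for a positive cone not containing 0: a subtraction-free
   expression in cone elements never vanishes, so that its inverse exists. *)
Variable pos : F -> Prop.
Hypotheses (pos1 : pos 1) (pos_neq0 : forall a, pos a -> a != 0).
Hypothesis posD : forall a b, pos a -> pos b -> pos (a + b).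
Hypothesis posM : forall a b, pos a -> pos b -> pos (a * b).
Hypothesis posV : forall a, pos a -> pos a^-1.

(* There is no scalar 0, so a zero value is known without being available. *)
Definition known vals a := a = 0 \/ pos a /\ available vals a.

Lemma known_prefix vals vals' a :
  prefix vals vals' -> known vals a -> known vals' a.
Proof. by move=> /available_prefix h [->|[? /h]]; [left|right]. Qed.

Lemma known_runs k vals vals' a :
  runs k vals vals' -> known vals a -> known vals' a.
Proof. by move/runs_prefix; apply: known_prefix. Qed.

Lemma known_pos vals a : known vals a -> a != 0 -> pos a.
Proof. by case=> [->|[]//]; rewrite eqxx. Qed.

Lemma known_add vals a b : known vals a -> known vals b ->
  exists2 vals', runs 1 vals vals' & known vals' (a + b).
Proof.
have triv c : known vals c -> exists2 vals', runs 1 vals vals' & known vals' c.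
  by move=> kc; exists vals => //; apply: runs_weaken _ (runs0 _).
case=> [->|[pa va]]; first by rewrite add0r; apply: triv.
case=> [->|[pb vb]]; first by rewrite addr0; apply: triv; right.
have [//|vals' rv v] := @available_gate Add vals a b (a + b) _ erefl va vb.
by exists vals' => //; right; split=> //; apply: posD.
Qed.

Lemma known_mul vals a b : known vals a -> known vals b ->
  exists2 vals', runs 1 vals vals' & known vals' (a * b).
Proof.
have triv c : c = 0 -> exists2 vals', runs 1 vals vals' & known vals' c.
  by exists vals; [apply: runs_weaken _ (runs0 _)|left].
case=> [->|[pa va]]; first by move=> _; rewrite mul0r; apply: triv.
case=> [->|[pb vb]]; first by rewrite mulr0; apply: triv.
have [//|vals' rv v] := @available_gate Mul vals a b (a * b) _ erefl va vb.
by exists vals' => //; right; split=> //; apply: posM.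
Qed.

Lemma known_div vals a b : known vals a -> known vals b -> b != 0 ->
  exists2 vals', runs 1 vals vals' & known vals' (a / b).
Proof.
case=> [->|[pa va]].
  by move=> _ _; exists vals; [apply: runs_weaken _ (runs0 _)|left; rewrite mul0r].
case=> [->|[pb vb] b0]; first by rewrite eqxx.
have [//||vals' rv v] := @available_gate Div vals a b (a / b) _ _ va vb.
  by rewrite /= (negPf b0).
by exists vals' => //; right; split=> //; apply/posM/posV.
Qed.

Lemma known_family (I : eqType) (s : seq I) (f : I -> F) k vals :
  (forall i vals', prefix vals vals' ->
     exists2 vals'', runs k vals' vals'' & known vals'' (f i)) ->
  exists2 vals', runs (size s * k) vals vals'
    & forall i, i \in s -> known vals' (f i).
Proof.
elim: s => [|i s IH] step; first by exists vals => //; apply: runs0.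
have [vals1 r1 k1] := IH step.
have [vals2 r2 k2] := step i _ (runs_prefix r1).
exists vals2; first by rewrite /= mulSn addnC; apply: runs_trans r2.
by move=> j; rewrite inE => /predU1P[->//|/k1]; apply: known_runs r2.
Qed.

Lemma known_sum (I : eqType) (s : seq I) (P : pred I) (f : I -> F) vals :
  (forall i, known vals (f i)) ->
  exists2 vals', runs (size s) vals vals'
    & known vals' (\sum_(i <- s | P i) f i).
Proof.
move=> kf; elim: s => [|i s [vals1 r1 k1]].
  by exists vals; [apply: runs0|left; rewrite big_nil].
rewrite big_cons; case: ifP => _; last first.
  by exists vals1 => //; apply: runs_weaken _ r1.
have [vals2 r2 k2] := known_add (known_runs r1 (kf i)) k1.
by exists vals2 => //=; rewrite -addn1; apply: runs_trans r2.
Qed.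

Lemma known_add_eq0 vals a b :
  known vals a -> known vals b -> a + b = 0 -> a = 0 /\ b = 0.
Proof.
case=> [->|[pa _]]; first by rewrite add0r.
case=> [->|[pb _]]; first by rewrite addr0.
by move/eqP; rewrite (negPf (pos_neq0 (posD pa pb))).
Qed.

Lemma known_sum_eq0 (I : eqType) (s : seq I) (P : pred I) (f : I -> F) vals i :
  (forall j, known vals (f j)) -> \sum_(j <- s | P j) f j = 0 ->
  i \in s -> P i -> f i = 0.
Proof.
move=> kf; elim: s => [|j s IH] //; rewrite big_cons inE.
case: ifP => Pj; last by move=> /IH h /predU1P[->|/h//]; rewrite Pj.
have [vals' r' k'] := known_sum s P kf.
by case/(known_add_eq0 (known_runs r' (kf j)) k') => fj0 /IH h /predU1P[->|/h].
Qed.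

(** * Vertex elimination carried out by gates *)

Variable V : finType.
Implicit Types (w : V -> V -> F) (S Z : {set V}) (v : V).

(** Cut form of the condition that every vertex of [S] reaches the complement of [S] along arcs of
    nonzero weight. *)
Definition escaping S w :=
  forall Z, Z \subset S -> Z != set0 ->
  exists x y, [/\ x \in Z, y \notin Z & w x y != 0].

(** An arc leaving the singleton of [v] is a nonzero summand of the outflow, and known summands
    cannot cancel. *)
Lemma escaping_outflow vals S w v :
  (forall x y, known vals (w x y)) -> escaping S w -> v \in S ->
  outflow w v != 0.
Proof.
move=> kw esc vS; have [||_ [y [/set1P-> yv wy]]] := esc [set v].
- by rewrite sub1set.
- by rewrite -cards_eq0 cards1.
apply: contra_neq wy => /known_sum_eq0; apply=> //.
by rewrite inE in yv.
Qed.

Lemma known_outflow vals w v : (forall x y, known vals (w x y)) ->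
  exists2 vals', runs #|V| vals vals' & known vals' (outflow w v).
Proof.
move=> kw; have -> : outflow w v = \sum_(z <- enum V | z != v) w v z.
  by rewrite big_enum_cond; apply: eq_bigl.
by rewrite cardE; apply: known_sum.
Qed.

Lemma eliminate_neq0 vals w v x y :
  (forall x y, known vals (w x y)) -> outflow w v != 0 -> y != v ->
  (w x y != 0) || (w x v != 0) && (w v y != 0) -> eliminate v w x y != 0.
Proof.
move=> kw D0 yv; rewrite /eliminate (negPf yv) -negb_or -mulf_eq0 -negb_and.
apply: contraNN => /eqP sum0; apply/andP.
(* The gates run here are discarded; they only certify that both summands are known. *)
have [vals1 r1 k1] := known_outflow v kw.
have [vals2 r2 k2] := known_div (known_runs r1 (kw x v)) k1 D0.
have [vals3 r3 k3] := known_mul k2 (known_runs r2 (known_runs r1 (kw v y))).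
have k4 := known_runs r3 (known_runs r2 (known_runs r1 (kw x y))).
have [-> /eqP] := known_add_eq0 k4 k3 sum0.
by rewrite !mulf_eq0 invr_eq0 (negPf D0) orbF eqxx.
Qed.

(* A set left only through v is left by way of v, since Z together with v has
   an outgoing arc too. *)
Lemma escaping_eliminate vals S w v :
  (forall x y, known vals (w x y)) -> v \in S -> escaping S w ->
  escaping (S :\ v) (eliminate v w).
Proof.
move=> kw vS esc Z; rewrite subsetD1 => /andP[ZS vZ] Z0.
have ne := eliminate_neq0 kw (escaping_outflow kw esc vS).
have [x [y [xZ yZ wxy]]] := esc Z ZS Z0.
have [yv|yv] := eqVneq y v; last first.
  by exists x, y; split=> //; apply: ne; rewrite // wxy.
rewrite yv {y yv yZ} in wxy.
have [||x' [y' []]] := esc (v |: Z); first by rewrite subUset sub1set vS.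
  by rewrite setU_eq0 negb_and Z0 orbT.
rewrite !inE negb_or => xZ' /andP[yv yZ] wxy'.
case/predU1P: xZ' => [x'v|xZ'].
  by exists x, y'; split=> //; apply: ne; rewrite // wxy -x'v wxy' orbT.
by exists x', y'; split=> //; apply: ne; rewrite // wxy'.
Qed.

(** The count is [#|V|] gates for the outflow, [#|V|] for the quotients [w x v / outflow w v],
    shared by all [y], and a multiplication and an addition for each pair [(x, y)]. *)
Lemma known_eliminate vals w v :
  (forall x y, known vals (w x y)) -> outflow w v != 0 ->
  exists2 vals', runs (2 * #|V| + 2 * #|V| ^ 2) vals vals'
    & known vals' (outflow w v) /\ forall x y, known vals' (eliminate v w x y).
Proof.
move=> kw D0; have [vals1 r1 k1] := known_outflow v kw.
have [vals2 r2 k2] : exists2 vals2, runs (size (enum V) * 1) vals1 vals2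
    & forall x, x \in enum V -> known vals2 (w x v / outflow w v).
  apply: known_family => x vals' p.
  by apply: known_div => //; apply: known_prefix p _ => //; apply: known_runs r1 _.
have [vals3 r3 k3] :
  exists2 vals3, runs (size (enum {: V * V}) * 2) vals2 vals3
    & forall xy, xy \in enum {: V * V} -> known vals3 (eliminate v w xy.1 xy.2).
  apply: known_family => -[x y] vals' p /=; rewrite /eliminate.
  case: ifP => _; first by exists vals'; [apply: runs_weaken _ (runs0 _)|left].
  have kw' x1 x2 : known vals' (w x1 x2).
    by apply/(known_prefix p)/(known_runs r2)/(known_runs r1).
  have kc : known vals' (w x v / outflow w v).
    by apply: known_prefix p _; apply: k2; rewrite mem_enum.
  have [vals4 r4 k4] := known_mul kc (kw' v y).
  have [vals5 r5 k5] := known_add (known_runs r4 (kw' x y)) k4.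
  by exists vals5 => //; apply: runs_trans r4 r5.
exists vals3; last first.
  split; first exact/(known_runs r3)/(known_runs r2).
  by move=> x y; apply: (k3 (x, y)); rewrite mem_enum.
apply: runs_weaken _ (runs_trans (runs_trans r1 r2) r3).
by rewrite -!cardE card_prod muln1 mul2n addnn -mulnn (mulnC 2).
Qed.

(** The determinant is the product of the pivots met on eliminating [S]; the [+ 1] pays for
    multiplying by each pivot. Cone membership is carried along to exclude the zero case of [known],
    leaving an available value. *)
Lemma known_det_laplacian vals S w :
  (forall x y, known vals (w x y)) -> escaping S w ->
  exists2 vals', runs (#|S| * (2 * #|V| + 2 * #|V| ^ 2 + 1)) vals vals'
    & pos (\det (laplacian S w)) /\ available vals' (\det (laplacian S w)).
Proof.
move: {2}#|S| (erefl #|S|) => m; elim: m => [|m IH] in vals S w *.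
  move/cards0_eq=> -> kw _; exists vals.
    by apply: runs_weaken _ (runs0 _).
  by rewrite det_laplacian_set0; split=> //; exists (@Scalar X 1 isT).
move=> Sm kw esc; have /card_gt0P[v vS] : (0 < #|S|)%N by rewrite Sm.
have D0 := escaping_outflow kw esc vS.
have [vals1 r1 [k1 kw1]] := known_eliminate kw D0.
have Sm1 : #|S :\ v| = m by move: Sm; rewrite (cardsD1 v) vS => -[].
have [vals2 r2 [p2 a2]] := IH vals1 _ _ Sm1 kw1 (escaping_eliminate kw vS esc).
rewrite (det_laplacian_eliminate vS D0).
have pD := known_pos k1 D0.
have [vals3 r3 k3] := known_mul (known_runs r2 k1) (or_intror (conj p2 a2)).
exists vals3.
  rewrite Sm mulSn addnAC; apply: runs_weaken _ (runs_trans (runs_trans r1 r2) r3).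
  by rewrite Sm1.
have p3 := posM pD p2; split=> //.
by case: k3 => [z|[]//]; move: (pos_neq0 p3); rewrite z eqxx.
Qed.

End Availability.

(** * Rooted parent functions *)

Section Rooted.

Variables (V : finType) (r : V).
Implicit Types (e t : rel V) (p q : V -> V) (d : V -> nat).

(** [d x] is the length of a shortest path from [x] to [r], and the first step of such a path lowers
    it. Later inductions use this rank instead of paths. *)
Lemma connect_descent e : (forall x, connect e x r) ->
  exists d, forall x, x != r -> exists2 y, e x y & d y < d x.
Proof.
move=> er; pose P x k := [exists c : k.-tuple V, path e x c && (last x c == r)].
have exP x : exists k, P x k.
  have /connectP[c pc lc] := er x; exists (size c).
  by apply/existsP; exists (in_tuple c); rewrite pc -lc eqxx.
exists (fun x => ex_minn (exP x)) => x xr.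
case: ex_minnP => k /existsP[[c kc] /= /andP[pc lc]] _.
case: c kc pc lc => [|y c] /= /eqP kc; first by rewrite (negPf xr).
case/andP=> exy pc lc.
exists y => //; case: ex_minnP => k' _; rewrite -kc; apply.
by apply/existsP; exists (in_tuple c); rewrite pc.
Qed.

Definition rooted p := (p r == r) && [forall x, fconnect p x r].

Lemma rooted_descent p : rooted p ->
  exists d, forall x, x != r -> d (p x) < d x.
Proof.
case/andP=> _ /forallP/connect_descent[d dP]; exists d => x /dP[y].
by move/eqP<-.
Qed.

Lemma descent_rooted d p :
  p r = r -> (forall x, x != r -> d (p x) < d x) -> rooted p.
Proof.
move=> pr dP; rewrite /rooted pr eqxx; apply/forallP => x.
have [k] := ubnP (d x); elim: k x => // k IH x dx.
have [->|xr] := eqVneq x r; first exact: connect0.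
by rewrite fconnect_eqVf IH ?orbT //; apply: leq_trans (dP _ xr) dx.
Qed.

Import GRing.Theory.
Local Open Scope ring_scope.

(** If [p] is rooted, only the identity permutation contributes, with diagonal entries 1. Otherwise
    the indicator of the vertices that never reach [r] is a nonzero kernel vector, being constant
    along [p] and zero at [r]. *)
Lemma det_parent_matrix (K : fieldType) (p : V -> V) : p r = r ->
  \det (\matrix_(i, j) ((i == j)%:R - (enum_val i != r)%:R *
         (p (enum_val i) == enum_val j)%:R) : 'M[K]_#|V|) = (rooted p)%:R.
Proof.
move=> pr; set B := \matrix_(i, j) _.
have [rp|] := boolP (rooted p).
  have [d dP] := rooted_descent rp.
  rewrite /determinant (bigD1 (1%g : {perm 'I_#|V|})) //= [X in _ + X]big1 => [|s s1].
    rewrite addr0 odd_perm1 mul1r big1 // => i _; rewrite perm1 !mxE eqxx.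
    case: (eqVneq (enum_val i) r) => [|ir]; first by rewrite mul0r subr0.
    case: eqP => [pi|]; last by rewrite mulr0 subr0.
    by have := dP _ ir; rewrite pi ltnn.
  suff [i /eqP Bi] : exists i, B i (s i) == 0.
    by rewrite (bigD1 i) //= Bi mul0r mulr0.
  (* A permutation without zero factor moves [i] only to its parent, which has smaller rank and so
     is fixed by induction; injectivity then gives [s i = i]. *)
  apply/existsP; apply: contraNT s1; rewrite negb_exists => /forallP Bs.
  apply/eqP/permP => i; rewrite perm1.
  have [k] := ubnP (d (enum_val i)); elim: k i => // k IH i di.
  have := Bs i; rewrite mxE; case: (eqVneq i (s i)) => // isi.
  case: (eqVneq (enum_val i) r) => [|ir]; first by rewrite mul0r subr0 eqxx.
  case: (p _ =P _) => [psi _|]; last by rewrite mulr0 subr0 eqxx.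
  have /IH : (d (enum_val (s i)) < k)%N.
    by rewrite -psi; apply: leq_trans (dP _ ir) di.
  by move/perm_inj.
rewrite /rooted pr eqxx /= => /forallPn[x0 x0r].
pose u : 'rV[K]_#|V| := \row_j (~~ fconnect p (enum_val j) r)%:R.
apply/eqP; rewrite -det_tr; apply/det0P; exists u.
  apply/eqP => /rowP/(_ (enum_rank x0)); rewrite !mxE enum_rankK x0r.
  by apply/eqP/oner_neq0.
apply/rowP => j; rewrite !mxE.
under eq_bigr => k _ do rewrite !mxE mulrBr.
rewrite sumrB (bigD1 j) //= eqxx mulr1 big1 ?addr0 => [|k /negPf]; last first.
  by rewrite eq_sym => ->; rewrite mulr0.
rewrite (bigD1 (enum_rank (p (enum_val j)))) //= enum_rankK eqxx mulr1.
rewrite big1 ?addr0 => [|k kp]; last first.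
  rewrite (negPf (_ : p (enum_val j) != enum_val k)) ?mulr0 //.
  by apply: contraNneq kp => ->; rewrite enum_valK.
have [jr|jr] := eqVneq (enum_val j) r.
  by rewrite jr connect0 mulr0 subr0.
by rewrite fconnect_eqVf (negPf jr) mulr1 subrr.
Qed.

End Rooted.

(** * Matrix-tree expansion over parent functions *)

Section MatrixTree.

Import GRing.Theory.
Local Open Scope ring_scope.

Lemma det_laplacian_rooted (K : fieldType) (V : finType) (r : V)
    (w : V -> V -> K) :
  \det (laplacian [set~ r] w) =
  \sum_(p : {ffun V -> V} | rooted r p) \prod_(x | x != r) w x (p x).
Proof.
(* The unit row of [r] is written as a sum too, with the single term [z = r]; functions moving [r]
   thus get weight 0. *)
pose F x z := if x == r then (z == r)%:R else w x z.
pose B x z y : K := (x == y)%:R - (x != r)%:R * (z == y)%:R.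
have entryE x y : laplacian_entry [set~ r] w x y = \sum_z F x z * B x z y.
  rewrite /laplacian_entry !inE /F /B; case: (eqVneq x r) => [->|xr] /=.
    rewrite (bigD1 r) //= eqxx big1 => [|z /negPf->]; last by rewrite mul0r.
    by rewrite mul1r mul0r subr0 addr0.
  under [RHS]eq_bigr do rewrite mul1r mulrBr.
  rewrite sumrB; congr (_ - _); first by rewrite -mulr_suml mulrC.
  rewrite (bigD1 y) //= eqxx mulr1 big1 ?addr0 // => z /negPf->.
  by rewrite mulr0.
pose A (p : {ffun V -> V}) : 'M[K]_#|V| :=
  \matrix_(i, j) B (enum_val i) (p (enum_val i)) (enum_val j).
transitivity (\sum_(p : {ffun V -> V}) (\prod_x F x (p x)) * \det (A p)).
  under [RHS]eq_bigr do rewrite mulr_sumr.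
  rewrite exchange_big /=; apply: eq_bigr => s _.
  rewrite (reindex enum_rank) /=; last exact/onW_bij/enum_rank_bij.
  under eq_bigr do rewrite mxE enum_rankK entryE.
  rewrite bigA_distr_bigA mulr_sumr; apply: eq_bigr => p _.
  rewrite mulrCA big_split /=; congr (_ * (_ * _)).
  rewrite [RHS](reindex enum_rank) /=; last exact/onW_bij/enum_rank_bij.
  by apply: eq_bigr => x _; rewrite mxE enum_rankK.
rewrite [RHS]big_mkcond; apply: eq_bigr => p _.
rewrite (bigD1 r) //= {1}/F eqxx.
case: (eqVneq (p r) r) => [pr|prr]; last first.
  by rewrite /rooted (negPf prr) !mul0r.
have -> : \det (A p) = (rooted r p)%:R.
  rewrite -det_parent_matrix //; congr (\det _); apply/matrixP=> i j.
  by rewrite !mxE /B (inj_eq enum_val_inj).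
rewrite mul1r; case: rooted; rewrite ?mulr0 // mulr1.
by apply: eq_bigr => x /negPf xr; rewrite /F xr.
Qed.

End MatrixTree.

(** * Trees and parent functions *)

Section Trees.

Variables (V : finType) (r : V).
Implicit Types (t : rel V) (p q : V -> V) (d : V -> nat).

Lemma eq_set2 (a b x y : V) : [set a; b] = [set x; y] ->
  (a = x /\ b = y) \/ (a = y /\ b = x).
Proof.
move=> /setP E.
have := E a; have := E b; have := E x; have := E y; rewrite !inE !eqxx /= !orbT.
do 4![move/esym]; rewrite ?(eq_sym x) ?(eq_sym y).
by case: (a =P x); case: (a =P y); case: (b =P x); case: (b =P y); auto.
Qed.

Definition cut t (x y : V) : rel V :=
  fun u v => t u v && ([set u; v] != [set x; y]).

Lemma cut_sym t x y : ssrbool.symmetric t -> ssrbool.symmetric (cut t x y).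
Proof. by move=> ts u v; rewrite /cut ts setUC. Qed.

(** A simple path from [x] to [y] that avoids the edge closes up with it to a cycle. *)
Lemma acyclic_bridge t x y : ssrbool.symmetric t -> acyclic_graph t ->
  x != y -> t x y -> ~~ connect (cut t x y) x y.
Proof.
move=> ts ac xy txy; apply/negP => /connectP[c0 pc0 lc0].
case: (shortenP pc0) lc0 => c pc uc _ lc {c0 pc0}.
have ck : size (x :: c) < #|V|.+1.
  by rewrite ltnS -(card_uniqP uc) max_card.
(* A path of length 0 is excluded by [x != y], one of length 1 by the removal of the edge. *)
have sz : 2 < size (x :: c).
  case: c pc lc {uc ck} => [_ e|z [|z' c]] //=; first by rewrite e eqxx in xy.
  by rewrite andbT => + e; rewrite -e /cut eqxx andbF.
have /implyP/(_ sz)/negP[] :=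
  forallP (forallP ac (Ordinal ck)) (in_tuple (x :: c)).
rewrite /ucycleb uc andbT /= rcons_path -lc ts txy andbT.
by apply: sub_path pc => u v /andP[].
Qed.

Definition parent_edge p : rel V :=
  fun x y => (x != r) && (p x == y) || (y != r) && (p y == x).

Lemma parent_edge_sym p : ssrbool.symmetric (parent_edge p).
Proof. by move=> x y; rewrite /parent_edge orbC. Qed.

(** Only parent edges of vertices of rank at most [d x] are required, so the lemma still applies
    after deleting the parent edge of a vertex of larger rank. *)
Lemma connect_ascent t p d x : (forall z, z != r -> d (p z) < d z) ->
  (forall z, z != r -> d z <= d x -> t z (p z)) -> connect t x r.
Proof.
move=> dP; have [k] := ubnP (d x); elim: k x => // k IH x dx tP.
have [->|xr] := eqVneq x r; first exact: connect0.
apply: connect_trans (connect1 (tP x xr (leqnn _))) _.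
apply: IH => [|z zr dz]; first exact: leq_trans (dP _ xr) dx.
by apply: tP => //; apply: leq_trans dz (ltnW (dP _ xr)).
Qed.

Lemma rooted_tree t p : rooted r p -> t =2 parent_edge p -> tree t.
Proof.
move=> rp tE; have [d dP] := rooted_descent rp.
have ts : ssrbool.symmetric t by move=> x y; rewrite !tE parent_edge_sym.
have xr x : connect t x r.
  by apply: connect_ascent dP _ => z zr _; rewrite tE /parent_edge zr eqxx.
apply/andP; split; first (apply/andP; split; first by apply/card_gt0P; exists r).
  apply/forallP => x; apply/forallP => y; apply: connect_trans (xr x) _.
  by rewrite (sym_connect_sym ts).
(* A vertex of a cycle that is farthest from the root would have two distinct
   neighbours, both equal to its parent. *)
apply/forallP => k; apply/forallP => c; apply/implyP => k2; apply/negP => uc.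
have [x0 x0c] : exists x0, x0 \in c.
  case: c uc => -[|x0 c] ck _; last by exists x0; rewrite mem_head.
  by rewrite -(eqP ck) in k2.
pose x := [arg max_(x > x0 in c) d x].
have [xc xmax] : x \in c /\ forall y, y \in c -> d y <= d x.
  by rewrite /x; case: arg_maxnP.
have [i c' cE] := rot_to xc.
have mem_c' y : y \in x :: c' -> d y <= d x.
  by rewrite -cE mem_rot; apply: xmax.
have : ucycle t (x :: c') by rewrite -cE rot_ucycle.
have sc' : 2 < size (x :: c') by rewrite -cE size_rot size_tuple.
case: c' sc' {cE} mem_c' => [|y c'] //; case/lastP: c' => [|c' z] // _ mem_c'.
case/andP; rewrite /= rcons_path last_rcons => /and3P[txy _ tzx] /and3P[_ + _].
rewrite mem_rcons inE negb_or => /andP[/eqP yz _]; apply: yz.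
have up u : u \in x :: y :: rcons c' z -> t x u -> u = p x.
  move=> /mem_c' du; rewrite tE => /orP[/andP[_ /eqP->]//|/andP[ur /eqP pu]].
  by have := dP _ ur; rewrite pu ltnNge du.
rewrite (up y) // ?inE ?eqxx ?orbT // (up z) // 1?ts //.
by rewrite !inE mem_rcons mem_head !orbT.
Qed.

(** [p] maps each vertex other than [r] to a neighbour closer to [r]. An edge of [t] that is not a
    parent edge could be cut while both its ends still climb to [r], contradicting that it is a
    bridge. *)
Lemma tree_rooted t : ssrbool.symmetric t -> irreflexive t -> tree t ->
  exists2 p : {ffun V -> V}, rooted r p & t =2 parent_edge p.
Proof.
move=> ts ti /andP[/andP[_ /forallP tc] ac].
have [d dP] := connect_descent (fun x => forallP (tc x) r).
pose p := [ffun x => if x == r then r else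
                     odflt r [pick y | t x y && (d y < d x)]].
have pP x : x != r -> t x (p x) && (d (p x) < d x).
  move=> xr; rewrite ffunE (negPf xr); case: pickP => //= none.
  by have [y ty dy] := dP x xr; have := none y; rewrite ty dy.
have dp x : x != r -> d (p x) < d x by case/pP/andP.
exists p => [|x y].
  by apply: descent_rooted dp; rewrite ffunE eqxx.
apply/idP/idP => [txy|]; last first.
  by case/orP=> /andP[/pP/andP[+ _] /eqP<-] //; rewrite ts.
have xy : x != y by apply: contraTneq txy => ->; rewrite ti.
apply: contraNT (acyclic_bridge ts ac xy txy); rewrite negb_or !negb_and !negbK.
case/andP=> xE yE.
have up u : connect (cut t x y) u r.
  apply: connect_ascent dp _ => z zr _; case/pP/andP: (zr) => tz _.
  rewrite /cut tz /=; apply/eqP => /eq_set2[] [zE pzE].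
    by rewrite -zE -pzE eqxx (negPf zr) in xE.
  by rewrite -zE -pzE eqxx (negPf zr) in yE.
apply: connect_trans (up x) _.
by rewrite (sym_connect_sym (cut_sym _ _ ts)).
Qed.

(** Induction on the rank for [q]: if [p x] differed from [q x], the edge would force [p (q x) = x],
    hence [q (q x) = x] by induction, which the decrease of [d] forbids. *)
Lemma parent_edge_inj p q : rooted r p -> rooted r q ->
  parent_edge p =2 parent_edge q -> p =1 q.
Proof.
move=> rp rq pq x; have [d dP] := rooted_descent rq.
have [/eqP pr _] := andP rp; have [/eqP qr _] := andP rq.
have [k] := ubnP (d x); elim: k x => // k IH x dx.
have [->|xr] := eqVneq x r; first by rewrite pr qr.
have : parent_edge p x (q x) by rewrite pq /parent_edge xr eqxx.
case/orP=> /andP[_ /eqP] //; rewrite IH; last exact: leq_trans (dP _ xr) dx.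
have [-> /eqP|qxr qqx] := eqVneq (q x) r; first by rewrite qr eq_sym (negPf xr).
have := dP _ xr; have := dP _ qxr; rewrite qqx => lt1 /(ltn_trans lt1).
by rewrite ltnn.
Qed.

End Trees.

(** * Spanning trees as parent functions *)

Section GeneratingFunction.

Import GRing.Theory.
Local Open Scope ring_scope.

(** One frame for both kinds of graph: [g x y] is the arc from [x] to [y], later [[set x; y]] or
    [(x, y)], and [P] selects the arcs of the graph. *)
Variables (V A : finType) (P : pred A) (g : V -> V -> A) (r : V).

Let E : finType := {a : A | P a}.

Definition parent_arcs (p : V -> V) : {set A} :=
  [set g x (p x) | x in [set~ r]].

(** Weight 0 for non-arcs lets the sum range over all rooted parent functions. *)
Definition arc_weight (a : A) : {mpoly rat[#|E|]} :=
  if insub a is Some e then 'X_(enum_rank (e : E)) else 0.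

(** Both sums run over the same arc sets, parametrised injectively by [T] on one side and by [p] on
    the other, once the parent functions using an arc outside [P], which contribute 0, are
    dropped. *)
Lemma generating_function_parents (Sp : pred {set E}) :
  (forall T : {set E}, Sp T <->
     exists2 p : {ffun V -> V}, rooted r p & val @: T = parent_arcs p) ->
  (forall p, rooted r p -> {in [set~ r] &, injective (fun x => g x (p x))}) ->
  (forall p q : {ffun V -> V}, rooted r p -> rooted r q ->
     parent_arcs p = parent_arcs q -> p = q) ->
  generating_function Sp =
  \sum_(p : {ffun V -> V} | rooted r p)
    \prod_(x | x != r) arc_weight (g x (p x)).
Proof.
move=> SpP g_inj arcs_inj; pose F (S : {set A}) := \prod_(a in S) arc_weight a.
have -> : generating_function Sp = \sum_(T in [set T | Sp T]) F (val @: T).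
  rewrite /generating_function; apply: eq_big => [T|T _]; first by rewrite inE.
  rewrite /F big_imset /=; last by move=> x y _ _; apply: val_inj.
  by apply: eq_bigr => e _; rewrite /arc_weight valK.
have -> : \sum_(p : {ffun V -> V} | rooted r p)
            \prod_(x | x != r) arc_weight (g x (p x)) =
          \sum_(p : {ffun V -> V} | rooted r p) F (parent_arcs p).
  apply: eq_bigr => p rp; rewrite /F big_imset /=; last exact: g_inj.
  by apply: eq_bigl => x; rewrite !inE.
pose Q := [set p : {ffun V -> V} | rooted r p & parent_arcs p \subset P].
rewrite (bigID (fun p : {ffun V -> V} => parent_arcs p \subset P)) /=.
rewrite [X in _ = _ + X]big1 ?addr0 => [|p /andP[_ /subsetPn[a pa Pa]]]; last first.
  by rewrite /F (bigD1 a) //= /arc_weight insubF ?mul0r //; apply: negbTE.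
have -> : \sum_(p : {ffun V -> V} | rooted r p && (parent_arcs p \subset P))
    F (parent_arcs p) = \sum_(p in Q) F (parent_arcs p).
  by apply: eq_bigl => p; rewrite inE.
rewrite -(big_imset F (h := fun T : {set E} => val @: T)) /=; last first.
  by move=> T U _ _; apply/imset_inj/val_inj.
rewrite -(big_imset F (h := fun p : {ffun V -> V} => parent_arcs p)) /=; last first.
  by move=> p q; rewrite !inE => /andP[rp _] /andP[rq _]; apply: arcs_inj.
apply: eq_bigl => S; apply/imsetP/imsetP => -[].
  move=> T; rewrite inE => /SpP[p rp Tp] ->; exists p => //.
  rewrite inE rp -Tp; apply/subsetP => _ /imsetP[e _ ->]; exact: valP.
move=> p; rewrite inE => /andP[rp /subsetP pP] ->.
exists [set e : E | val e \in parent_arcs p]; last first.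
  apply/setP => a; apply/idP/imsetP => [pa|[e + ->]]; last by rewrite inE.
  by exists (Sub a (pP a pa)); rewrite ?inE SubK.
rewrite inE; apply/SpP; exists p => //.
apply/setP => a; apply/imsetP/idP => [[e + ->]|pa]; first by rewrite inE.
by exists (Sub a (pP a pa)); rewrite ?inE SubK.
Qed.

End GeneratingFunction.

(** * Undirected spanning trees *)

Section Undirected.

Variables (V : finType) (G : rel V) (r : V).

Let g (x y : V) : {set V} := [set x; y].

Lemma adjacentE (T : {set edge G}) x y :
  adjacent T x y = ([set x; y] \in val @: T).
Proof.
apply/existsP/imsetP => [[e /andP[eT /eqP eE]]|[e eT eE]]; first by exists e.
by exists e; rewrite eT -eE eqxx.
Qed.

Lemma parent_edgeE (p : V -> V) x y :
  parent_edge r p x y = ([set x; y] \in parent_arcs g r p).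
Proof.
apply/orP/imsetP => [[] /andP[zr /eqP pz]|[z]].
- by exists x; rewrite ?inE // /g pz.
- by exists y; rewrite ?inE // /g pz setUC.
by rewrite !inE => zr /eq_set2[] [-> ->]; rewrite zr eqxx; [left|right].
Qed.

Lemma undirected_parents : irreflexive G -> forall T : {set edge G},
  spanning_tree T <->
  exists2 p : {ffun V -> V}, rooted r p & val @: T = parent_arcs g r p.
Proof.
move=> Gi T; split=> [spT|[p rp Tp]]; last first.
  by apply: (rooted_tree rp) => x y; rewrite adjacentE parent_edgeE Tp.
have edgeP (e : edge G) : exists x y, x != y /\ val e = [set x; y].
  case: e => e /= /imset2P[x y _]; rewrite !inE => Gxy ->; exists x, y.
  by split=> //; apply: contraTneq Gxy => ->; rewrite Gi.
have [||p rp pE] := tree_rooted r _ _ spT.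
- by move=> x y; rewrite !adjacentE setUC.
- move=> x; apply/existsP => -[e /andP[_ /eqP]].
  have [a [b [ab ->]]] := edgeP e.
  by case/eq_set2=> -[ax bx]; rewrite ax bx eqxx in ab.
exists p => //; apply/setP => s; apply/idP/idP => [sT|/imsetP[x xr ->]].
  have /imsetP[e _ se] := sT; have [x [y [_ eE]]] := edgeP e.
  by rewrite se eE -parent_edgeE -pE adjacentE -eE -se.
by rewrite -adjacentE pE /parent_edge -in_setC1 xr eqxx.
Qed.

Lemma undirected_parent_inj (p : V -> V) : rooted r p ->
  {in [set~ r] &, injective (fun x => g x (p x))}.
Proof.
move=> /rooted_descent[d dP] x y; rewrite !inE => xr yr /eq_set2[] [] // xE yE.
have := dP _ xr; have := dP _ yr; rewrite yE -xE => lt1 /(ltn_trans lt1).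
by rewrite ltnn.
Qed.

Lemma undirected_parent_arcs_inj (p q : {ffun V -> V}) :
  rooted r p -> rooted r q -> parent_arcs g r p = parent_arcs g r q -> p = q.
Proof.
move=> rp rq pq; apply/ffunP; apply: (parent_edge_inj rp rq) => x y.
by rewrite !parent_edgeE pq.
Qed.

End Undirected.

(** * Directed spanning trees *)

Section Directed.

Variables (V : finType) (G : rel V) (r : V).

Let g (x y : V) : V * V := (x, y).

Lemma mem_parent_arcs (p : V -> V) x y :
  ((x, y) \in parent_arcs g r p) = (x != r) && (p x == y).
Proof.
apply/imsetP/andP => [[z]|[xr /eqP<-]]; last by exists x; rewrite ?inE.
by rewrite !inE => zr [-> ->].
Qed.

Lemma adjacent_unorientedE (T : {set directed_edge G}) x y :
  adjacent_unoriented T x y = ((x, y) \in val @: T) || ((y, x) \in val @: T).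
Proof.
apply/existsP/orP => [[a /andP[aT /orP[]/eqP aE]]|[]/imsetP[a aT aE]].
- by left; apply/imsetP; exists a.
- by right; apply/imsetP; exists a.
- by exists a; rewrite aT aE eqxx.
- by exists a; rewrite aT aE eqxx orbT.
Qed.

(** Opposite arcs would make the rank decrease in both directions. For the orientation, the climb
    from the target of [a] only uses arcs leaving vertices of rank below that of the source of [a],
    hence never [a]. *)
Lemma parents_directed (p : V -> V) (T : {set directed_edge G}) :
  rooted r p -> val @: T = parent_arcs g r p -> directed_spanning_tree r T.
Proof.
move=> rp Tp; have [d dP] := rooted_descent rp.
have arcP (a : directed_edge G) : a \in T ->
    source_of a != r /\ p (source_of a) = target_of a.
  move/(imset_f val); rewrite Tp [val a]surjective_pairing mem_parent_arcs.
  by case/andP=> ? /eqP.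
apply/and3P; split.
- apply/forallP => a; apply/implyP => aT; apply/forallP => b; apply/implyP => bT.
  have [ar pa] := arcP a aT; have [br pb] := arcP b bT.
  apply/eqP => ab; have := dP _ ar; have := dP _ br; rewrite pa pb.
  rewrite {2}/target_of {2}/source_of ab /= => lt1 /(ltn_trans lt1).
  by rewrite ltnn.
- apply: (rooted_tree rp) => x y.
  by rewrite adjacent_unorientedE Tp !mem_parent_arcs.
- apply/forallP => a; apply/implyP => aT; have [ar pa] := arcP a aT.
  apply: (connect_ascent dP) => z zr dz; rewrite adjacent_unorientedE.
  have /imsetP[b bT bE] : (z, p z) \in val @: T.
    by rewrite Tp mem_parent_arcs zr eqxx.
  apply/orP; left; apply/imsetP; exists b => //; rewrite !inE bT andbT.
  apply: contraTneq dz => ba; rewrite -ltnNge -pa.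
  by have := dP _ ar; rewrite /source_of -ba -bE.
Qed.

(** The arcs of [T] must agree with the parent function of the unoriented tree. Were [(x, y)] an arc
    with [p y = x], then after its removal [y] would still reach [r] by the orientation and [x] by
    its smaller rank, contradicting that the edge is a bridge. *)
Lemma directed_parents (T : {set directed_edge G}) :
  irreflexive G -> directed_spanning_tree r T ->
  exists2 p : {ffun V -> V}, rooted r p & val @: T = parent_arcs g r p.
Proof.
move=> Gi /and3P[opp spT ori].
have ts : ssrbool.symmetric (adjacent_unoriented T).
  by move=> x y; rewrite !adjacent_unorientedE orbC.
have ti : irreflexive (adjacent_unoriented T).
  move=> x; rewrite adjacent_unorientedE orbb; apply/imsetP => -[a _ xa].
  by have := valP a; rewrite -xa /= Gi.
have [p rp pE] := tree_rooted r ts ti spT; exists p => //.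
have [d dP] := rooted_descent rp.
have arcP x y : (x, y) \in val @: T -> (x != r) && (p x == y).
  move=> xyT; have txy : adjacent_unoriented T x y.
    by rewrite adjacent_unorientedE xyT.
  have xy : x != y by apply: contraTneq txy => ->; rewrite ti.
  have := txy; rewrite pE => /orP[//|/andP[yr /eqP py]].
  have /imsetP[a aT aE] := xyT.
  (* Absence of opposite arcs ensures that deleting [a] deletes the whole unoriented edge. *)
  have sub_cut : subrel (adjacent_unoriented (T :\ a))
                        (cut (adjacent_unoriented T) x y).
    move=> u v; rewrite /cut !adjacent_unorientedE.
    have nab b : b \in T :\ a -> val b <> (x, y) /\ val b <> (y, x).
      rewrite !inE => /andP[ba bT]; split=> bE.
        by case/eqP: ba; apply: val_inj; rewrite bE.
      have /implyP/(_ aT)/forallP/(_ b)/implyP/(_ bT) := forallP opp a.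
      by rewrite /target_of /source_of -aE bE eqxx.
    have nin c : c \in val @: (T :\ a) -> [/\ c \in val @: T, c <> (x, y) & c <> (y, x)].
      move=> /imsetP[b bTa ->]; have [? ?] := nab b bTa; split=> //.
      by apply: imset_f; case/setD1P: bTa.
    case/orP=> /nin[-> n1 n2]; rewrite ?orbT /=; apply/eqP => /eq_set2[] [uE vE];
      by rewrite uE vE in n1 n2.
  have cs := sym_connect_sym (cut_sym x y ts).
  have yc : connect (cut (adjacent_unoriented T) x y) y r.
    have /implyP/(_ aT) := forallP ori a; rewrite /target_of -aE /=.
    by apply: connect_sub => u v /sub_cut/connect1.
  have xc : connect (cut (adjacent_unoriented T) x y) x r.
    have dxy : d x < d y by rewrite -py; apply: dP.
    apply: (connect_ascent dP) => z zr dz.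
    rewrite /cut pE /parent_edge zr eqxx /=; apply/eqP => /eq_set2[] [zE pzE].
      by have := dP _ zr; rewrite pzE zE ltnNge (ltnW dxy).
    by rewrite zE leqNgt dxy in dz.
  have /negP[] := acyclic_bridge ts (proj2 (andP spT)) xy txy.
  by apply: connect_trans xc _; rewrite cs.
apply/setP => -[x y]; rewrite mem_parent_arcs; apply/idP/idP; first exact: arcP.
case/andP=> xr /eqP<-; have : adjacent_unoriented T x (p x).
  by rewrite pE /parent_edge xr eqxx.
rewrite adjacent_unorientedE => /orP[//|/arcP/andP[pr /eqP pp]].
have := dP _ xr; have := dP _ pr; rewrite pp => lt1 /(ltn_trans lt1).
by rewrite ltnn.
Qed.

Lemma directed_parent_arcs_inj (p q : {ffun V -> V}) :
  rooted r p -> rooted r q -> parent_arcs g r p = parent_arcs g r q -> p = q.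
Proof.
move=> /andP[/eqP pr _] /andP[/eqP qr _] pq; apply/ffunP => x.
have [->|xr] := eqVneq x r; first by rewrite pr qr.
have : (x, p x) \in parent_arcs g r p by rewrite mem_parent_arcs xr eqxx.
by rewrite pq mem_parent_arcs => /andP[_ /eqP].
Qed.

End Directed.

(** * The circuit *)

Section Positivity.

Import Order.TTheory GRing.Theory Num.Theory.
Local Open Scope ring_scope.

Variables (R : idomainType) (K : numDomainType) (ev : {rmorphism R -> K}).
Implicit Types (a b : R) (f g : {fraction R}).

(** The cone used for [pos]. It is defined through a representative with both parts positive under
    [ev], as [ev] need not extend to fractions. *)
Definition positive_fraction f :=
  exists a b, [/\ 0 < ev a, 0 < ev b & f = tofrac a / tofrac b].

Lemma tofrac_neq0 a : 0 < ev a -> tofrac a != 0.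
Proof. by rewrite tofrac_eq0; apply: contraTneq => ->; rewrite rmorph0 ltxx. Qed.

Lemma positive_fraction_tofrac a : 0 < ev a -> positive_fraction (tofrac a).
Proof. by exists a, 1; rewrite rmorph1 tofrac1 divr1. Qed.

Lemma positive_fraction1 : positive_fraction 1.
Proof. by rewrite -tofrac1; apply: positive_fraction_tofrac; rewrite rmorph1. Qed.

Lemma positive_fraction_neq0 f : positive_fraction f -> f != 0.
Proof.
case=> a [b [/tofrac_neq0 a0 /tofrac_neq0 b0 ->]].
by apply: mulf_neq0; rewrite ?invr_eq0.
Qed.

Lemma positive_fractionD f g :
  positive_fraction f -> positive_fraction g -> positive_fraction (f + g).
Proof.
case=> a [b [a0 b0 ->]] [c [d [c0 d0 ->]]]; exists (a * d + c * b), (b * d).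
rewrite rmorphD !rmorphM /= addr_gt0 ?mulr_gt0 //; split=> //.
by rewrite tofracD !tofracM addf_div ?tofrac_neq0.
Qed.

Lemma positive_fractionM f g :
  positive_fraction f -> positive_fraction g -> positive_fraction (f * g).
Proof.
case=> a [b [a0 b0 ->]] [c [d [c0 d0 ->]]]; exists (a * c), (b * d).
by rewrite !rmorphM /= !mulr_gt0 // mulf_div.
Qed.

Lemma positive_fractionV f : positive_fraction f -> positive_fraction f^-1.
Proof. by case=> a [b [a0 b0 ->]]; exists b, a; rewrite invf_div. Qed.

End Positivity.

(** * Circuits for sums over parent functions *)

Section Main.

Import GRing.Theory.
Local Open Scope ring_scope.

Lemma connect_exit (V : finType) (e : rel V) (Z : {set V}) x y :
  connect e x y -> x \in Z -> y \notin Z ->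
  exists u v, [/\ u \in Z, v \notin Z & e u v].
Proof.
case/connectP=> c; elim: c x => [|z c IH] x /=.
  by move=> _ -> xZ; rewrite xZ.
case/andP=> exz pc yE xZ yZ; have [zZ|zZ] := boolP (z \in Z).
  exact: (IH z).
by exists x, z.
Qed.

Lemma parent_gf_circuit (V A : finType) (P : pred A) (g : V -> V -> A) (r : V) :
  (forall v, connect (fun x y => P (g x y)) v r) ->
  exists c : circuit {a : A | P a},
    [/\ subtraction_free c,
        computes c (\sum_(p : {ffun V -> V} | rooted r p)
          \prod_(x | x != r) arc_weight P (g x (p x)))
      & (circuit_size c <= 5 * #|V| ^ 3)%N].
Proof.
move=> reach; pose E : finType := {a : A | P a}.
pose rho (e : E) := tofrac ('X_(enum_rank e) : {mpoly rat[#|E|]}).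
(* At the all-ones point every variable takes a positive value. *)
pose ev := @meval #|E| rat (fun=> 1) : {rmorphism {mpoly rat[#|E|]} -> rat}.
pose w x y := tofrac (arc_weight P (g x y)).
have kw x y : known rho (positive_fraction ev) [::] (w x y).
  rewrite /w /arc_weight; case: insubP => [e _ _|_]; last by left; apply: tofrac0.
  right; split; last by exists (Var e).
  by apply: positive_fraction_tofrac; rewrite /= mevalXU.
have wP x y : P (g x y) -> w x y != 0.
  by move=> Pg; rewrite /w /arc_weight insubT; apply: (tofrac_neq0 (ev := ev)); rewrite /= mevalXU.
have esc : escaping [set~ r] w.
  move=> Z Zr /set0Pn[x xZ]; have rZ : r \notin Z.
    by apply/negP => /(subsetP Zr); rewrite !inE eqxx.
  have [u [v [uZ vZ /wP wuv]]] := connect_exit (reach x) xZ rZ.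
  by exists u, v.
have [vals [gs [fgs sgs valsE]] [_ [s sE]]] :=
  known_det_laplacian (positive_fraction1 ev) (@positive_fraction_neq0 _ _ ev)
    (@positive_fractionD _ _ ev) (@positive_fractionM _ _ ev)
    (@positive_fractionV _ _ ev) kw esc.
exists (Circuit gs s); split=> //.
  rewrite /computes /circuit_val /= valsE sE det_laplacian_rooted rmorph_sum.
  by congr Some; apply: eq_bigr => p _; rewrite rmorph_prod.
apply: leq_trans sgs _; have V0 : (0 < #|V|)%N by apply/card_gt0P; exists r.
apply: leq_trans (leq_mul (max_card _) (leqnn _)) _.
(* The 5 comes from [2 * n + 2 * n ^ 2 + 1 <= 5 * n ^ 2] for [n > 0]. *)
rewrite (_ : 5 * #|V| ^ 3 = #|V| * (2 * #|V| ^ 2 + 2 * #|V| ^ 2 + #|V| ^ 2))%N.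
  rewrite leq_mul2l; apply/orP; right.
  by rewrite leq_add ?expn_gt0 ?V0 // leq_add2r leq_mul2l /= -mulnn leq_pmulr.
by rewrite expnS mulnCA -mulnDl -mulSnr.
Qed.

End Main.

Theorem theorem2p8 :
  (exists C : nat, forall (V : finType) (G : rel V),
     ssrbool.symmetric G -> irreflexive G -> connected_graph G ->
     exists c : circuit (edge G),
       [/\ subtraction_free c,
           computes c (spanning_tree_gf G) &
           (circuit_size c <= C * #|V| ^ 3)%N])
  /\
  (exists C : nat, forall (V : finType) (G : rel V) (r : V),
     irreflexive G -> (forall v : V, connect G v r) ->
     exists c : circuit (directed_edge G),
       [/\ subtraction_free c,
           computes c (directed_spanning_tree_gf G r) &
           (circuit_size c <= C * #|V| ^ 3)%N]).
Proof.
split; exists 5 => V G.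
  (* Any vertex serves as root, and [[set x; y]] gives both orientations the same variable. *)
  move=> _ Gi /andP[/card_gt0P[r _] /forallP Gc].
  rewrite /spanning_tree_gf (generating_function_parents (r := r)
    (undirected_parents r Gi) (@undirected_parent_inj V r)
    (@undirected_parent_arcs_inj V r)).
  apply: (parent_gf_circuit (P := fun e => e \in edge_set G)
    (g := fun x y => [set x; y])) => v; have := forallP (Gc v) r.
  apply: connect_sub => x y Gxy; apply: connect1.
  by apply/imset2P; exists x y => //; rewrite inE.
move=> r Gi Gr; have TP (T : {set directed_edge G}) : directed_spanning_tree r T <->
    exists2 p : {ffun V -> V}, rooted r p & val @: T = parent_arcs pair r p.
  by split=> [/(directed_parents Gi)|[p]]; last exact: parents_directed.
rewrite /directed_spanning_tree_gf (generating_function_parents (r := r) TP _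
  (@directed_parent_arcs_inj V r)) => [|p _ x y _ _ [->]//].
exact: (parent_gf_circuit (P := fun a => G a.1 a.2) (g := pair)).
Qed.
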